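(* Let $X$ be an $n$-dimensional Euclidean or Hermitian space with orthonormal basis $(v_1,\ldots,v_n)$, and let $H=\sum_{\mathbf{i}\in\mathcal{I}^n_p}\lambda_{\mathbf{i}}v_{\mathbf{i}}\in\bigwedge^p X$ with scalars $\lambda_{\mathbf{i}}$. Then $H$ is simple (i.e. a blade) if, and only if, $$\sum_{\mathbf{k}_2\in\mathcal{I}^n_2,\ \mathbf{k}_2\subset\mathbf{k}\backslash\mathbf{j}}(-1)^{|\mathbf{j}\triangle\mathbf{k}>\mathbf{k}_2|}\,\lambda_{\mathbf{j}\cup\mathbf{k}_2}\,\lambda_{\mathbf{k}\backslash\mathbf{k}_2}=0\qquad\text{for all }\mathbf{j}\in\mathcal{I}^n_{p-2},\ \mathbf{k}\in\mathcal{I}^n_{p+2}.$$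
   Context: A Euclidean space is a finite-dimensional real inner product space; a Hermitian space is a finite-dimensional complex space with Hermitian inner product. $\bigwedge X$ is the exterior algebra. A blade (simple multivector) is a scalar or an exterior product $v_1\wedge\cdots\wedge v_p$ of vectors; $0$ is regarded as a blade. Multi-indices: $\mathcal{I}^q_p=\{(i_1,\ldots,i_p)\in\mathbb{N}^p:1\le i_1<\cdots<i_p\le q\}$ for $p\ge 1$, $\mathcal{I}^q_0=\{\emptyset\}$, and $\mathcal{I}^q_p=\emptyset$ if $p<0$ or $p>q$. For $\mathbf{i}=(i_1,\ldots,i_p)$, $v_{\mathbf{i}}=v_{i_1}\wedge\cdots\wedge v_{i_p}$, and $v_\emptyset=1$. Increasing multi-indices are identified with the sets of their entries; $\mathbf{i}\cup\mathbf{j}$, $\mathbf{i}\backslash\mathbf{j}$, $\mathbf{i}\triangle\mathbf{j}$ denote the union, difference and symmetric difference, written in increasing order. $|\mathbf{r}>\mathbf{s}|$ is the number of pairs $(i,j)$ with $i\in\mathbf{r}$, $j\in\mathbf{s}$ and $i>j$. *)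

(* Defs.v *)
From HB Require Import structures.
From mathcomp Require Import all_boot all_order all_algebra.
From mathcomp Require Import reals complex.

Set Implicit Arguments.
Unset Strict Implicit.
Unset Printing Implicit Defensive.

Import Order.TTheory GRing.Theory Num.Theory.
Local Open Scope ring_scope.

(* The inner product of X is a form in {dot X for theta}, where theta is the
   conjugation of the scalars: trivial for Euclidean spaces, complex
   conjugation for Hermitian ones. *)
Variant real_or_complex : forall K : numFieldType, {rmorphism K -> K} -> Prop :=
| RealScalars (R : realType) :
    @real_or_complex R (idfun : {rmorphism R -> R})
| ComplexScalars (R : realType) :
    @real_or_complex R[i] (Num.conj : {rmorphism R[i] -> R[i]}).

(* The exterior algebra of X is only determined up to a unique isomorphism: it
   is any unital associative algebra A with a linear map iota : X -> A that is
   universal among the linear maps to algebras whose values square to 0. The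
   product of A is the exterior product, and k%:A is the scalar k. *)
Record is_exterior_algebra (K : fieldType) (X : vectType K) (A : algType K)
    (iota : {linear X -> A}) : Prop := IsExteriorAlgebra {
  exterior_square0 : forall x : X, iota x * iota x = 0;
  exterior_universal : forall (B : algType K) (f : {linear X -> B}),
    (forall x : X, f x * f x = 0) ->
    exists2 g : {lrmorphism A -> B},
      forall x : X, g (iota x) = f x
      & forall h : {lrmorphism A -> B},
          (forall x : X, h (iota x) = f x) -> h =1 g }.

Definition is_blade (K : fieldType) (X : vectType K) (A : algType K)
    (iota : {linear X -> A}) (w : A) : Prop :=
  (exists c : K, w = c%:A) \/
  (exists (q : nat) (x : 'I_q -> X), (0 < q)%N /\ w = \prod_(i < q) iota (x i)).

(* Increasing multi-indices are encoded by their sets of entries, with entries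
   numbered from 0. The length is an integer because I^n_(p-2) is needed for
   every p, and must be empty when p < 2. *)
Definition multi_index (n : nat) (p : int) : {set {set 'I_n}} :=
  [set I : {set 'I_n} | (#|I| : int) == p].

(* |r > s| *)
Definition count_gt (n : nat) (r s : {set 'I_n}) : nat :=
  #|[set ij : 'I_n * 'I_n | [&& ij.1 \in r, ij.2 \in s & (ij.2 < ij.1)%N]]|.

Definition symdiff (n : nat) (r s : {set 'I_n}) : {set 'I_n} :=
  (r :\: s) :|: (s :\: r).

(* v_I: enum I lists the elements of I in increasing order. *)
Definition wedge (K : fieldType) (X : vectType K) (A : algType K)
    (iota : {linear X -> A}) (n : nat) (v : n.-tuple X) (I : {set 'I_n}) : A :=
  \prod_(i <- enum I) iota (tnth v i).

(* Main.v *)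
Require Import Defs.
From HB Require Import structures.
From mathcomp Require Import all_boot all_order all_algebra.
From mathcomp Require Import reals complex.
From mathcomp Require Import ring zify.

Set Implicit Arguments.
Unset Strict Implicit.
Unset Printing Implicit Defensive.

Import Order.TTheory GRing.Theory Num.Theory.
Local Open Scope ring_scope.

(* Let f be the coordinate function of H in a concrete model of the exterior
   algebra. Up to a sign, the relation for (j, k) says that the k-th coordinate
   of (f contracted by the dual basis covectors of j) * f vanishes. If f is a
   product of p vectors, its contraction by p - 2 covectors is a combination of
   products of two of these vectors, hence is annihilated by f.

   Conversely, choose I with f_I <> 0 and let x_i be the vector obtained by
   contracting f by I minus i. The contraction of g = \prod_(i in I) x_i by
   I minus i is a multiple of x_i, so f and g are proportional on the sets S
   with |I - S| <= 1. Both satisfy the relations. If a and b are distinct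
   elements of I - S, the relation for j = I - {a, b} and k = S + {a, b} has
   the form e * f_I * f_S + (terms at sets closer to I) = 0, with
   e = 1, -1, 2 or -2, so all coordinates are determined by those with
   |I - S| <= 1, and f is proportional to g. *)

(** * Parity of signs and sums over disjoint unions *)

Lemma eq_signr (R : pzRingType) (a b : nat) :
  odd a = odd b -> (-1) ^+ a = (-1) ^+ b :> R.
Proof. by move=> eq_ab; rewrite -[LHS]signr_odd eq_ab signr_odd. Qed.

Lemma sum_setU_disjoint (T : finType) (A B : {set T}) (F : T -> nat) :
  [disjoint A & B] ->
  (\sum_(i in A :|: B) F i = \sum_(i in A) F i + \sum_(i in B) F i)%N.
Proof.
by move=> dAB; rewrite -bigU //; apply: eq_bigl => i; rewrite !inE.
Qed.

(** * The inversion count *)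

Section CountGt.
Variable n : nat.
Implicit Types (r s t : {set 'I_n}) (i : 'I_n).

Lemma count_gtE r s : count_gt r s = (\sum_(i in r) \sum_(j in s) (j < i))%N.
Proof.
rewrite /count_gt pair_big_dep -sum1_card /= [RHS]big_mkcond [LHS]big_mkcond.
by apply: eq_bigr => -[i j] _; rewrite inE /=; case: (i \in r); case: (j \in s);
  case: (_ < _)%N.
Qed.

Lemma count_gt0l s : count_gt set0 s = 0%N.
Proof. by rewrite count_gtE big_set0. Qed.

Lemma count_gt0r r : count_gt r set0 = 0%N.
Proof. by rewrite count_gtE big1 // => i _; rewrite big_set0. Qed.

Lemma count_gtUl r s t : [disjoint r & s] ->
  count_gt (r :|: s) t = (count_gt r t + count_gt s t)%N.
Proof. by move=> rs; rewrite !count_gtE sum_setU_disjoint. Qed.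

Lemma count_gtUr r s t : [disjoint s & t] ->
  count_gt r (s :|: t) = (count_gt r s + count_gt r t)%N.
Proof.
move=> st; rewrite !count_gtE -big_split /=; apply: eq_bigr => i _.
by rewrite sum_setU_disjoint.
Qed.

(** A pair with one entry in each of two disjoint sets is an inversion in exactly one of the two
    orders. *)
Lemma count_gt_swap r s : [disjoint r & s] ->
  (count_gt r s + count_gt s r)%N = (#|r| * #|s|)%N.
Proof.
move=> rs; rewrite !count_gtE [X in (_ + X)%N]exchange_big /= -big_split /=.
rewrite -sum_nat_const; apply: eq_bigr => i ri.
rewrite -big_split /= -sum1_card; apply: eq_bigr => j sj.
suff: val i != val j by case: ltngtP.
by apply: contraTneq sj => /val_inj <-; rewrite (disjointFr rs).
Qed.

Lemma count_gt11 i j : count_gt [set i] [set j] = (j < i)%N.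
Proof. by rewrite count_gtE !big_set1. Qed.

Lemma count_gt_self2 s : #|s| = 2%N -> count_gt s s = 1%N.
Proof.
move=> /eqP/cards2P[a [b [ab ->]]].
have dab : [disjoint [set a] & [set b]] by rewrite disjoints1 inE.
rewrite (count_gtUl _ dab) !count_gtUr // !count_gt11 !ltnn.
by move: ab; rewrite -val_eqE /=; case: ltngtP.
Qed.

End CountGt.

(** * Concrete exterior algebra *)

(* The value of [f : ext K n] at [S] is its coordinate on the basis blade [v_S]. *)
Definition ext (K : fieldType) (n : nat) : Type := {ffun {set 'I_n} -> K}.

Section ExtAlgebra.
Variables (K : fieldType) (n : nat).
Local Notation E := (ext K n).
Implicit Types (f g h : E) (S T I : {set 'I_n}).

HB.instance Definition _ := GRing.Zmodule.copy E {ffun {set 'I_n} -> K}.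

Definition ext_scale (a : K) f : E := [ffun S : {set 'I_n} => a * f S].
Fact ext_scaleA a b f : ext_scale a (ext_scale b f) = ext_scale (a * b) f.
Proof. by apply/ffunP => S; rewrite !ffunE mulrA. Qed.
Fact ext_scale1 : left_id 1 ext_scale.
Proof. by move=> f; apply/ffunP => S; rewrite ffunE mul1r. Qed.
Fact ext_scaleDr : right_distributive ext_scale +%R.
Proof. by move=> a f g; apply/ffunP => S; rewrite !ffunE mulrDr. Qed.
Fact ext_scaleDl f : {morph ext_scale^~ f : a b / a + b}.
Proof. by move=> a b; apply/ffunP => S; rewrite !ffunE mulrDl. Qed.
HB.instance Definition _ := GRing.Zmodule_isLmodule.Build K E
  ext_scaleA ext_scale1 ext_scaleDr ext_scaleDl.

Definition ext_one : E := [ffun S : {set 'I_n} => (S == set0)%:R].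
(** The sign sorts the concatenation of [I] and [S :\: I] into increasing order, which makes this
    the exterior product written in the basis of the blades [v_S]. *)
Definition ext_mul f g : E :=
  [ffun S : {set 'I_n} => \sum_(I : {set 'I_n} | I \subset S)
               (-1) ^+ count_gt I (S :\: I) * f I * g (S :\: I)].

(** Both sides are sums over the splittings of [S] into three successive blocks; the sign counts the
    inversions between blocks, and this count is additive in each argument. *)
Fact ext_mulA : associative ext_mul.
Proof.
move=> f g h; apply/ffunP => S; rewrite !ffunE.
under [RHS]eq_bigr => I IS do rewrite ffunE mulr_sumr mulr_suml.
rewrite [RHS](exchange_big_dep (fun J : {set 'I_n} => J \subset S)) /=; last first.
  by move=> I J IS JI; apply: subset_trans IS.
apply: eq_bigr => J JS; rewrite ffunE mulr_sumr.
rewrite [RHS](reindex_onto (fun L : {set 'I_n} => J :|: L) (fun I => I :\: J)) /=;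
  last first.
  by move=> I /andP[_ JI]; rewrite setDE setUIr setUCr setIT; apply/setUidPr.
apply: eq_big => [L|L].
  rewrite subsetUl andbT subUset JS /= setDUl setDv set0U subsetD.
  by case: (_ \subset _) => //=; rewrite (sameP eqP setDidPl).
rewrite subsetD => /andP[LS LJ].
have JL : [disjoint J & L] by rewrite disjoint_sym.
have JLK : (J :|: L) :\: J = L by rewrite setDUl setDv set0U; apply/setDidPl.
have SJL : S :\: J = L :|: (S :\: (J :|: L)).
  apply/setP => x; rewrite !inE; case xL: (x \in L) => /=; last by rewrite orbF.
  by rewrite (disjointFr LJ xL) (subsetP LS).
rewrite JLK setDDl SJL count_gtUr; last first.
  by rewrite -setI_eq0 setDUr; apply/eqP/setP => x; rewrite !inE;
    case: (x \in L); rewrite ?andbF.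
rewrite count_gtUl //.
by rewrite !exprD; ring.
Qed.

Fact ext_mul1f : left_id ext_one ext_mul.
Proof.
move=> f; apply/ffunP => S; rewrite ffunE (bigD1 set0) ?sub0set //= ffunE eqxx.
rewrite count_gt0l setD0 !mul1r big1 ?addr0 // => I /andP[_ I0].
by rewrite ffunE (negPf I0) mulr0 mul0r.
Qed.

Fact ext_mulf1 : right_id ext_one ext_mul.
Proof.
move=> f; apply/ffunP => S; rewrite ffunE (bigD1 S) //= ffunE setDv eqxx.
rewrite count_gt0r mul1r mulr1 big1 ?addr0 // => I /andP[IS neIS].
rewrite ffunE setD_eq0 (_ : S \subset I = false) ?mulr0 //.
by apply: contraNF neIS => SI; rewrite eqEsubset IS.
Qed.

Fact ext_mulDl : left_distributive ext_mul +%R.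
Proof.
move=> f g h; apply/ffunP => S; rewrite !ffunE -big_split.
by apply: eq_bigr => I _; rewrite !ffunE mulrDr mulrDl.
Qed.

Fact ext_mulDr : right_distributive ext_mul +%R.
Proof.
move=> f g h; apply/ffunP => S; rewrite !ffunE -big_split.
by apply: eq_bigr => I _; rewrite !ffunE mulrDr.
Qed.

Fact ext_one_neq0 : ext_one != 0.
Proof. by apply/eqP => /ffunP/(_ set0)/eqP; rewrite !ffunE eqxx oner_eq0. Qed.

HB.instance Definition _ := GRing.Zmodule_isNzRing.Build E
  ext_mulA ext_mul1f ext_mulf1 ext_mulDl ext_mulDr ext_one_neq0.

Fact ext_scaleAl (a : K) f g : a *: (f * g) = (a *: f) * g.
Proof.
apply/ffunP => S; rewrite !ffunE mulr_sumr; apply: eq_bigr => I _.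
by rewrite !ffunE; ring.
Qed.
HB.instance Definition _ := GRing.Lmodule_isLalgebra.Build K E ext_scaleAl.

Fact ext_scaleAr (a : K) f g : a *: (f * g) = f * (a *: g).
Proof.
apply/ffunP => S; rewrite !ffunE mulr_sumr; apply: eq_bigr => I _.
by rewrite !ffunE; ring.
Qed.
HB.instance Definition _ := GRing.Lalgebra_isAlgebra.Build K E ext_scaleAr.

Lemma extME f g S : (f * g) S = \sum_(I : {set 'I_n} | I \subset S)
   (-1) ^+ count_gt I (S :\: I) * f I * g (S :\: I).
Proof. by rewrite ffunE. Qed.

Lemma ext1E S : (1 : E) S = (S == set0)%:R.
Proof. by rewrite ffunE. Qed.

Lemma extZE (a : K) f S : (a *: f) S = a * f S.
Proof. by rewrite ffunE. Qed.

Lemma extDE f g S : (f + g) S = f S + g S.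
Proof. by rewrite ffunE. Qed.

Lemma extNE f S : (- f) S = - f S.
Proof. by rewrite ffunE. Qed.

Lemma ext0E S : (0 : E) S = 0.
Proof. by rewrite ffunE. Qed.

Lemma ext_sumE (I : Type) (r : seq I) (P : pred I) (F : I -> E) S :
  (\sum_(i <- r | P i) F i) S = \sum_(i <- r | P i) F i S.
Proof. exact: (big_morph (fun f : E => f S) (fun f g => extDE f g S) (ext0E S)). Qed.

Lemma extP f g : (forall S, f S = g S) -> f = g.
Proof. by move=> fg; apply/ffunP. Qed.

End ExtAlgebra.

Section CountGt1.
Variable n : nat.
Implicit Types (S : {set 'I_n}) (i m : 'I_n).

Lemma count_gt1U i m S : m \notin S ->
  count_gt [set i] (m |: S) = ((m < i) + count_gt [set i] S)%N.
Proof. by move=> mS; rewrite count_gtUr ?disjoints1 // count_gt11. Qed.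

Lemma count_gt1D i m S : m \in S ->
  count_gt [set i] S = ((m < i) + count_gt [set i] (S :\ m))%N.
Proof. by move=> mS; rewrite -count_gt1U ?setD1K // !inE eqxx. Qed.

End CountGt1.

(** * Contraction by dual basis covectors *)

Section Contraction.
Variables (K : fieldType) (n : nat).
Local Notation E := (ext K n).
Implicit Types (f g h : E) (S T I : {set 'I_n}) (i m : 'I_n).
Implicit Types (x y : {ffun 'I_n -> K}) (xs ys : seq {ffun 'I_n -> K}).

Definition ext_basis i : E := [ffun S : {set 'I_n} => (S == [set i])%:R].

Definition ext_vec x : E := \sum_i x i *: ext_basis i.

(** The interior product with the [i]-th dual basis covector: the sign moves [v_i] to the front of
    the blade at [i |: S], where it is removed. *)
Definition contr i f : E := [ffun S : {set 'I_n} =>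
  if i \in S then 0 else (-1) ^+ count_gt [set i] S * f (i |: S)].

Definition contrs (s : seq 'I_n) f : E := foldl (fun g i => contr i g) f s.

Lemma contrE i f S : contr i f S =
  if i \in S then 0 else (-1) ^+ count_gt [set i] S * f (i |: S).
Proof. by rewrite ffunE. Qed.

Lemma contrs_cons i s f : contrs (i :: s) f = contrs s (contr i f).
Proof. by []. Qed.

Fact contr_is_linear i : linear (contr i).
Proof.
move=> a f g; apply: extP => S; rewrite !ffunE; case: ifP => _.
  by rewrite mulr0 addr0.
by ring.
Qed.
HB.instance Definition _ i :=
  GRing.isLinear.Build K E E *:%R (contr i) (contr_is_linear i).

Fact contrs_is_linear s : linear (contrs s).
Proof.
move=> a; elim: s => // i s IHs f g; rewrite !contrs_cons linearP; apply: IHs.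
Qed.
HB.instance Definition _ s :=
  GRing.isLinear.Build K E E *:%R (contrs s) (contrs_is_linear s).

Lemma ext_basisM i f S : (ext_basis i * f) S =
  if i \in S then (-1) ^+ count_gt [set i] S * f (S :\ i) else 0.
Proof.
have zero I : I != [set i] ->
    (-1) ^+ count_gt I (S :\: I) * ext_basis i I * f (S :\: I) = 0.
  by move=> /negPf neIi; rewrite ffunE neIi mulr0 mul0r.
rewrite extME; case: ifP => [iS|/negP iS].
  rewrite (bigD1 [set i]) ?sub1set //= ffunE eqxx mulr1.
  rewrite (count_gt1D _ iS) ltnn add0n big1 ?addr0 // => I /andP[_]; exact: zero.
rewrite big1 // => I IS; apply: zero; apply: contra_notN iS => /eqP eqI.
by rewrite -sub1set -eqI.
Qed.

(** For [m != i], exactly one of [i < m] and [m < i] contributes an extra inversion, whence the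
    minus sign; for [m = i] the two signs coincide and cancel. All later contractions rest on this
    antiderivation rule. *)
Lemma contr_basisM i m f :
  contr i (ext_basis m * f) = (m == i)%:R *: f - ext_basis m * contr i f.
Proof.
apply: extP => S; rewrite contrE extDE extNE extZE !ext_basisM !contrE !inE.
have [<-{i}|mi] := eqVneq m i; last rewrite orFb mul0r sub0r.
  have [mS|mS] := boolP (m \in S).
    rewrite /= setD1K // (count_gt1D _ mS) ltnn add0n mulrA -exprD addnn.
    by rewrite -signr_odd odd_double !mul1r subrr.
  rewrite /= subr0 (count_gt1U _ mS) ltnn add0n setU1K // mulrA -exprD addnn.
  by rewrite -signr_odd odd_double.
rewrite /=.
have [iS|iS] := boolP (i \in S); first by case: ifP; rewrite ?mulr0 oppr0.
have [mS|mS] := boolP (m \in S); last by rewrite mulr0 oppr0.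
have <- : (i |: S) :\ m = i |: S :\ m.
  by rewrite setDUl (setDidPl _) // disjoints1 inE eq_sym.
rewrite !mulrA -!exprD -mulNr; congr (_ * _); rewrite -[RHS]mulN1r -exprS.
apply: eq_signr; rewrite (count_gt1U _ iS) (count_gt1D i mS) /= !oddD.
have : m != i :> nat by [].
by case: ltngtP => //= _ _; do 2! case: (odd _).
Qed.

Lemma contr_vecM i x f :
  contr i (ext_vec x * f) = x i *: f - ext_vec x * contr i f.
Proof.
rewrite /ext_vec !mulr_suml linear_sum /= -sumrN (bigD1 i) //= [in RHS](bigD1 i) //=.
rewrite -!scalerAl linearZ /= contr_basisM eqxx scale1r scalerBr addrA.
congr (_ + _); apply: eq_bigr => m mi.
by rewrite -!scalerAl linearZ /= contr_basisM (negPf mi) scale0r sub0r scalerN.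
Qed.

Lemma ext_basis_anticomm i m f :
  ext_basis i * (ext_basis m * f) = - (ext_basis m * (ext_basis i * f)).
Proof.
apply: extP => S; rewrite extNE !ext_basisM !inE.
have [<-{i}|mi] := eqVneq m i; first by rewrite /= !mulr0 !if_same oppr0.
rewrite /=.
have [iS|iS] := boolP (i \in S); last by rewrite mulr0 if_same oppr0.
have [mS|mS] := boolP (m \in S); last by rewrite mulr0 oppr0.
rewrite !mulrA -!exprD -mulNr setDDl setUC -setDDl; congr (_ * _).
rewrite -[RHS]mulN1r -exprS; apply: eq_signr.
rewrite (count_gt1D _ mS) (count_gt1D m iS) /= !oddD.
have : m != i :> nat by [].
by case: ltngtP => //= _ _; do 2! case: (odd _).
Qed.

Lemma contr1 i : contr i 1 = 0.
Proof.
apply: extP => S; rewrite contrE ext1E ext0E setU_eq0 -cards_eq0 cards1 /= mulr0.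
by rewrite if_same.
Qed.

Definition ext_prod xs : E := \prod_(x <- xs) ext_vec x.

Lemma ext_prod_nil : ext_prod [::] = 1.
Proof. by rewrite /ext_prod big_nil. Qed.

Lemma ext_prod_cons x xs : ext_prod (x :: xs) = ext_vec x * ext_prod xs.
Proof. by rewrite /ext_prod big_cons. Qed.

Lemma ext_vecM x f S : (ext_vec x * f) S =
  \sum_(i in S) (-1) ^+ count_gt [set i] S * x i * f (S :\ i).
Proof.
rewrite /ext_vec mulr_suml ext_sumE [RHS]big_mkcond; apply: eq_bigr => i _ /=.
rewrite -scalerAl extZE ext_basisM; case: ifP => _; last by rewrite mulr0.
by ring.
Qed.

Lemma ext_prod_homogeneous xs S : #|S| != size xs -> ext_prod xs S = 0.
Proof.
elim: xs S => [|x xs IHxs] S /=.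
  by rewrite ext_prod_nil ext1E cards_eq0 => /negPf->.
rewrite ext_prod_cons ext_vecM => sizeS; rewrite big1 // => i iS.
by rewrite IHxs ?mulr0 //; move: sizeS; rewrite (cardsD1 i S) iS.
Qed.

(** Iterating the antiderivation rule, the covector passes [t] vectors before it is evaluated at the
    next one, which it removes. *)
Lemma contr_prod i ys : contr i (ext_prod ys) =
  \sum_(t < size ys)
    ((-1) ^+ t * nth 0 ys t i) *: ext_prod (take t ys ++ drop t.+1 ys).
Proof.
elim: ys => [|y ys IHys]; first by rewrite big_ord0 ext_prod_nil contr1.
rewrite ext_prod_cons contr_vecM IHys big_ord_recl /= drop0 mul1r; congr (_ + _).
rewrite mulr_sumr -sumrN; apply: eq_bigr => t _.
by rewrite ext_prod_cons /= exprS mulN1r mulNr scaleNr -scalerAr.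
Qed.

(** The exponent [e] counts the inversions of the list [s] itself; what matters later is that it is
    the same for all [f] and [S]. *)
Lemma contrsE (s : seq 'I_n) : uniq s -> exists e, forall f S,
  contrs s f S = if [disjoint S & [set:: s]]
    then (-1) ^+ (e + count_gt [set:: s] S) * f ([set:: s] :|: S) else 0.
Proof.
elim: s => [_|i s IHs]; last rewrite cons_uniq => /andP[i_s /IHs[e eE]].
  exists 0%N => f S; rewrite set_nil -setI_eq0 setI0 eqxx count_gt0l.
  by rewrite mul1r set0U.
exists (e + count_gt [set i] [set:: s])%N => f S.
rewrite set_cons contrs_cons eE contrE in_setU !inE (negPf i_s) /=.
have -> : [disjoint S & i |: [set:: s]] =
    (i \notin S) && [disjoint S & [set:: s]].
  by rewrite -!setI_eq0 setIUr setU_eq0 !setI_eq0 disjoint_sym disjoints1.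
case: ifP => dS; last by rewrite andbF.
have [iS|iS] /= := boolP (i \in S); first by rewrite mulr0.
rewrite mulrA -exprD setUA; congr (_ * _); congr (_ ^+ _).
rewrite count_gtUr 1?disjoint_sym // count_gtUl ?disjoints1 ?inE //.
by rewrite -!addnA; congr addn; rewrite addnC -addnA; congr addn; rewrite addnC.
Qed.
End Contraction.

(** * The two-step relations *)

(** Entries common to [r] and [s] are counted twice on the right, so [symdiff r s] gives the parity
    of the sum of the two counts. *)
Lemma count_gt_symdiff (n : nat) (r s t : {set 'I_n}) :
  (count_gt (symdiff r s) t + (count_gt (r :&: s) t).*2 =
   count_gt r t + count_gt s t)%N.
Proof.
rewrite /symdiff count_gtUl; last first.
  by rewrite -setI_eq0; apply/eqP/setP => x; rewrite !inE;
    case: (x \in r); rewrite ?andbF.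
have split a b : count_gt a t = (count_gt (a :&: b) t + count_gt (a :\: b) t)%N.
  rewrite -count_gtUl ?setID // -setI_eq0; apply/eqP/setP => x; rewrite !inE.
  by case: (x \in b); rewrite ?andbF.
by rewrite (split r s) (split s r) [s :&: r]setIC -addnn; lia.
Qed.

(** * Products of vectors satisfy the relations *)

Section ProductOfVectors.
Variables (K : numFieldType) (n : nat).
Local Notation E := (ext K n).
Implicit Types (f g h : E) (S T I : {set 'I_n}) (i m : 'I_n).
Implicit Types (x y : {ffun 'I_n -> K}) (xs ys : seq {ffun 'I_n -> K}).

Lemma ext_vec_anticomm x y f :
  ext_vec x * (ext_vec y * f) = - (ext_vec y * (ext_vec x * f)).
Proof.
rewrite /ext_vec !mulr_suml -sumrN.
under eq_bigr do rewrite mulr_sumr.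
under [RHS]eq_bigr do rewrite mulr_sumr -sumrN.
rewrite exchange_big /=; apply: eq_bigr => i _; apply: eq_bigr => m _.
rewrite -!scalerAl -!scalerAr -!scalerN -ext_basis_anticomm !scalerA.
by rewrite [x m * _]mulrC.
Qed.

(** Anticommutation makes twice the square vanish, and 2 is nonzero in [K]. *)
Lemma ext_vec_sqr0 x : ext_vec x * ext_vec x = 0.
Proof.
have /eqP := ext_vec_anticomm x x 1; rewrite mulr1 -subr_eq0 opprK.
rewrite -mulr2n -scaler_nat scaler_eq0 pnatr_eq0 /=; exact: eqP.
Qed.

Lemma ext_vec_prod0 y xs : y \in xs -> ext_vec y * ext_prod xs = 0.
Proof.
elim: xs => //= x xs IHxs; rewrite inE ext_prod_cons => /predU1P[->|/IHxs yxs].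
  by rewrite mulrA ext_vec_sqr0 mul0r.
by rewrite ext_vec_anticomm yxs mulr0 oppr0.
Qed.

Lemma ext_prod_prod0 ys xs :
  {subset ys <= xs} -> (0 < size ys)%N -> ext_prod ys * ext_prod xs = 0.
Proof.
elim: ys => // y [|z ys] IHys sub _; rewrite ext_prod_cons.
  by rewrite ext_prod_nil mulr1 ext_vec_prod0 // sub ?mem_head.
rewrite -mulrA IHys ?mulr0 // => w wys; apply: sub; rewrite inE wys.
exact: orbT.
Qed.

(** Each contraction deletes one factor per term, so every remaining term still contains a vector of
    [xs], and such a vector is annihilated by [ext_prod xs]. *)
Lemma contrs_prod0 (s : seq 'I_n) ys xs : {subset ys <= xs} ->
  (size s < size ys)%N -> contrs s (ext_prod ys) * ext_prod xs = 0.
Proof.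
elim: s ys => [|i s IHs] ys sub ltsy; first exact: ext_prod_prod0.
rewrite contrs_cons contr_prod linear_sum mulr_suml big1 // => t _ /=.
rewrite linearZ /= -scalerAl IHs ?scaler0 // => [x|].
  rewrite mem_cat => /orP[/mem_take|/mem_drop]; exact: sub.
rewrite size_cat size_takel ?size_drop; last exact/ltnW/ltn_ord.
by have := ltn_ord t; move: ltsy => /=; lia.
Qed.

Definition two_step_relations (p : nat) (lambda : {set 'I_n} -> K) : Prop :=
  forall j k : {set 'I_n},
     j \in multi_index n (p%:Z - 2) -> k \in multi_index n (p%:Z + 2) ->
     \sum_(k2 in multi_index n 2 | k2 \subset k :\: j)
        (-1) ^+ count_gt (symdiff j k) k2
          * lambda (j :|: k2) * lambda (k :\: k2) = 0.

Lemma multi_indexE (p : nat) S : (S \in multi_index n p) = (#|S| == p).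
Proof. by rewrite inE. Qed.

Lemma multi_indexD2 (p : nat) S :
  (S \in multi_index n (p%:Z + 2)) = (#|S| == p + 2)%N.
Proof. by rewrite inE. Qed.

Lemma multi_indexB2 (p : nat) S :
  (S \in multi_index n (p%:Z - 2)) = (#|S| + 2 == p)%N.
Proof. by rewrite inE -[in RHS]eqz_nat PoszD -subr_eq opprK. Qed.

(* Up to the factor [+-1], the relation for [j] and [k] is the [k]-th
   coordinate of the product of [f], contracted by [j], with [f]. *)
Lemma contrsM_eq0 (s : seq 'I_n) f k : uniq s ->
    (forall S, #|S| != (size s + 2)%N -> f S = 0) ->
    contrs s f * f = 0 ->
  \sum_(k2 in multi_index n 2 | k2 \subset k :\: [set:: s])
    (-1) ^+ count_gt (symdiff [set:: s] k) k2
      * f ([set:: s] :|: k2) * f (k :\: k2) = 0.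
Proof.
move=> s_uniq f_hom /(congr1 (fun g : E => g k)).
have [e ->] : exists e, (contrs s f * f) k = (-1) ^+ e *
  \sum_(k2 in multi_index n 2 | k2 \subset k :\: [set:: s])
    (-1) ^+ count_gt (symdiff [set:: s] k) k2
      * f ([set:: s] :|: k2) * f (k :\: k2); last first.
  by rewrite ext0E => /eqP; rewrite mulf_eq0 signr_eq0 => /eqP.
(* The shift by one accounts for the single inversion inside the pair [I], which is part of
   [count_gt k I]; as [#|I|] is even, the rest has the parity of [count_gt I (k :\: I)]. *)
have [e eE] := contrsE K s_uniq; exists e.+1; set j := [set:: s] in eE *.
have size_s : size s = #|j| by rewrite cardsE; apply/esym/card_uniqP.
rewrite extME mulr_sumr [LHS]big_mkcond [RHS]big_mkcond; apply: eq_bigr => I _.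
rewrite multi_indexE subsetD eE andbCA.
case: ifP => //= Ik; case: ifP => [dIj|]; last by rewrite andbF mulr0 mul0r.
rewrite andbT; have [cI|cI] := eqVneq #|I| 2%N; last first.
  rewrite f_hom ?mulr0 ?mul0r // size_s cardsU disjoint_setI0 1?disjoint_sym //.
  by rewrite cards0 subn0 eqn_add2l.
rewrite !mulrA -!exprD; congr (_ * _ * _); apply: eq_signr.
have := congr1 odd (count_gt_symdiff j k I).
have dI : [disjoint I & k :\: I] by rewrite -setI_eq0 setIDA setDIl setDv set0I.
have -> : count_gt k I = (count_gt (k :\: I) I).+1.
  by rewrite -[in LHS](setID k I) (setIidPr Ik) count_gtUl // count_gt_self2.
have := congr1 odd (count_gt_swap dI).
rewrite [in RHS]oddM cI /= !oddD /= odd_double addbF.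
by do 5! case: (odd _).
Qed.

Lemma two_step_relations_prod xs : two_step_relations (size xs) (ext_prod xs).
Proof.
move=> j k; rewrite multi_indexB2 => /eqP cj _.
have jE : [set:: enum j] = j by apply/setP => i; rewrite inE mem_enum.
rewrite -jE; apply: contrsM_eq0; first exact: enum_uniq.
  by move=> S; rewrite -cardE cj; apply: ext_prod_homogeneous.
by apply: contrs_prod0 => //; rewrite -cardE -cj addn2 ltnW.
Qed.

End ProductOfVectors.

(** * Recovering the vectors from a solution of the relations *)

Section Factorization.
Variables (K : numFieldType) (n : nat).
Local Notation E := (ext K n).
Implicit Types (f g h : E) (S T I : {set 'I_n}) (i m : 'I_n).
Implicit Types (x y : {ffun 'I_n -> K}) (xs ys : seq {ffun 'I_n -> K}).
Implicit Types (lambda mu : {set 'I_n} -> K).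

Lemma ext_vecE x i : ext_vec x [set i] = x i.
Proof.
rewrite /ext_vec ext_sumE (bigD1 i) //= extZE ffunE eqxx mulr1 big1 ?addr0 //.
move=> m mi; rewrite extZE ffunE (inj_eq set1_inj) eq_sym (negPf mi).
exact: mulr0.
Qed.

Lemma ext_vecZ (a : K) x : ext_vec [ffun i => a * x i] = a *: ext_vec x.
Proof.
rewrite /ext_vec scaler_sumr; apply: eq_bigr => i _.
by rewrite ffunE scalerA.
Qed.

Lemma ext_prodZ (a : K) xs : (0 < size xs)%N ->
  exists2 ys, size ys = size xs & ext_prod ys = a *: ext_prod xs.
Proof.
case: xs => // x xs _; exists ([ffun i => a * x i] :: xs) => //.
by rewrite !ext_prod_cons ext_vecZ scalerAl.
Qed.

Lemma contr_prod_eq0 i ys :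
  (forall y, y \in ys -> y i = 0) -> contr i (ext_prod ys) = 0.
Proof.
move=> ys0; rewrite contr_prod big1 // => t _.
by rewrite ys0 ?mem_nth // mulr0 scale0r.
Qed.

Lemma contrs_vecM (s : seq 'I_n) x f : (forall i, i \in s -> x i = 0) ->
  contrs s (ext_vec x * f) = (-1) ^+ size s *: (ext_vec x * contrs s f).
Proof.
elim: s f => [|i s IHs] f xs0; first by rewrite scale1r.
rewrite !contrs_cons contr_vecM xs0 ?mem_head // scale0r sub0r -mulrN IHs.
  by rewrite !linearN mulrN /= exprS mulN1r scaleNr scalerN.
by move=> m ms; rewrite xs0 // inE ms orbT.
Qed.

Section DualFamily.
Variable X : 'I_n -> {ffun 'I_n -> K}.

(** The vectors are dual to the covectors of [s] up to nonzero factors: contracting by [a] kills all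
    vectors after [X a], so only the product of the diagonal values [X a a] is left. *)
Lemma contrs_prod_dual (s : seq 'I_n) : uniq s ->
    {in s &, forall a b, (X b a == 0) = (a != b)} ->
  exists2 c, c != 0 & contrs s (ext_prod (map X s)) = c *: 1.
Proof.
elim: s => [_ _|a s IHs /andP[a_s s_uniq] dual].
  by exists 1; rewrite ?oner_eq0 // scale1r ext_prod_nil.
have [b d bs ds|c c_neq0 cE] := IHs s_uniq.
  by apply: dual; rewrite inE ?bs ?ds orbT.
exists (X a a * c); first by rewrite mulf_neq0 // dual ?mem_head ?eqxx.
rewrite map_cons contrs_cons ext_prod_cons contr_vecM.
rewrite contr_prod_eq0 ?mulr0 ?subr0 ?linearZ /= ?cE ?scalerA //.
move=> _ /mapP[b bs ->]; apply/eqP; rewrite dual ?mem_head ?inE ?bs ?orbT //.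
by apply: contraNneq a_s => ->.
Qed.

(** Each covector consumes its own dual vector, and [X i], whose covector is absent, is all that
    survives. *)
Lemma contrs_prod_rem (s : seq 'I_n) i : uniq s -> i \in s ->
    {in s &, forall a b, (X b a == 0) = (a != b)} ->
  exists2 c, c != 0 & contrs (rem i s) (ext_prod (map X s)) = c *: ext_vec (X i).
Proof.
elim: s => //= a s IHs /andP[a_s s_uniq] ias dual.
have dual_s : {in s &, forall a b, (X b a == 0) = (a != b)}.
  by move=> b d bs ds; apply: dual; rewrite inE ?bs ?ds orbT.
have neq_a b : b \in s -> a != b by apply: contraTneq => <-.
rewrite ext_prod_cons; have [ai|ai] := eqVneq a i.
  have [c c_neq0 cE] := contrs_prod_dual s_uniq dual_s.
  exists ((-1) ^+ size s * c); first by rewrite mulf_neq0 ?signr_eq0.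
  rewrite -ai contrs_vecM ?cE -?scalerAr ?mulr1 ?scalerA // => b bs.
  apply/eqP; rewrite dual ?mem_head ?inE ?bs ?orbT //.
  by rewrite eq_sym neq_a.
have is_ : i \in s by move: ias; rewrite inE eq_sym (negPf ai).
have [c c_neq0 cE] := IHs s_uniq is_ dual_s.
exists (X a a * c); first by rewrite mulf_neq0 // dual ?mem_head ?eqxx.
rewrite contrs_cons contr_vecM contr_prod_eq0 ?mulr0 ?subr0 ?linearZ /= ?cE.
  by rewrite scalerA.
move=> _ /mapP[b bs ->]; apply/eqP.
by rewrite dual ?mem_head ?inE ?bs ?orbT // neq_a.
Qed.

End DualFamily.

(** Induction on [#|I :\: S|]: once the values at closer sets are known, the chosen relation is
    linear in the value at [S], and its coefficient is a nonzero multiple of [lambda I]. *)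
Lemma two_step_relations_unique (p : nat) lambda mu I :
    two_step_relations p lambda -> two_step_relations p mu ->
    #|I| = p -> lambda I != 0 ->
    (forall S, #|S| = p -> (#|I :\: S| <= 1)%N -> lambda S = mu S) ->
  forall S, #|S| = p -> lambda S = mu S.
Proof.
move=> rel_lambda rel_mu cI lambdaI low S.
have [m] := ubnP #|I :\: S|; elim: m S => // m IHm S ltm cS.
have [|lt1] := leqP #|I :\: S| 1; first exact: low.
have muI : mu I = lambda I by rewrite low // setDv cards0.
have /card_gt1P[a [b [aIS bIS ab]]] := lt1.
move: aIS bIS; rewrite !inE => /andP[aS aI] /andP[bS bI].
(* These choices make [k2 = [set a; b]] contribute exactly the product of the values at [I] and
   [S]. *)
pose j := I :\: [set a; b]; pose k := S :|: [set a; b].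
have cab : #|[set a; b]| = 2%N by rewrite cards2 ab.
have abI : [set a; b] \subset I by rewrite subUset !sub1set aI bI.
have dSab : [disjoint S & [set a; b]].
  by rewrite disjoint_sym -setI_eq0 setIUl setU_eq0 !setI_eq0 !disjoints1 aS.
have cj : j \in multi_index n (p%:Z - 2).
  by rewrite multi_indexB2 cardsD (setIidPr abI) cab cI subnK // -cI -cab subset_leq_card.
have ck : k \in multi_index n (p%:Z + 2).
  by rewrite multi_indexD2 cardsU disjoint_setI0 // cards0 subn0 cS cab.
have jab : j :|: [set a; b] = I.
  by rewrite /j setDE setUIl setUC (setUidPr abI) [_ :|: _]setUC setUCr setIT.
have kab : k :\: [set a; b] = S by rewrite /k setDUl setDv setU0 (setDidPl _).
have kj : k :\: j = (S :\: I) :|: [set a; b].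
  by apply/setP => x; rewrite !inE; case: (x == a); case: (x == b);
    case: (x \in I); case: (x \in S).
pose term (f : {set 'I_n} -> K) k2 := f (j :|: k2) * f (k :\: k2).
have sum0 : \sum_(k2 in multi_index n 2 | k2 \subset k :\: j)
    (-1) ^+ count_gt (symdiff j k) k2 * (term lambda k2 - term mu k2) = 0.
  under eq_bigr do rewrite mulrBr !mulrA.
  by rewrite sumrB rel_lambda // rel_mu // subrr.
have eq_term (k2 : {set 'I_n}) : #|k2| = 2%N -> k2 \subset k :\: j -> k2 != [set a; b] ->
    k2 != S :\: I -> term lambda k2 = term mu k2.
  move=> c2 sub ne_ab ne_SI; rewrite /term.
  have k2k : k2 \subset k by apply: subset_trans sub (subsetDl _ _).
  have dj : [disjoint j & k2].
    by move: sub; rewrite subsetD disjoint_sym => /andP[].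
  have c_jk2 : #|j :|: k2| = p.
    by move: cj; rewrite multi_indexB2 cardsU disjoint_setI0 // cards0 subn0 c2 => /eqP.
  have c_kk2 : #|k :\: k2| = p.
    by move: ck; rewrite multi_indexD2 cardsD (setIidPr k2k) c2 => /eqP->; rewrite addnK.
  (* Since [k2] differs from [[set a; b]], removing it from [k] loses at most one of [a] and [b],
     both of which [S] lacks; hence [k :\: k2] is closer to [I] than [S] is. *)
  have cap1 : (#|k2 :&: [set a; b]| <= 1)%N.
    rewrite leqNgt; apply: contra ne_ab => cap2.
      rewrite eq_sym eqEcard c2 cab leqnn andbT.
    by apply/setIidPr/eqP; rewrite eqEcard subsetIr cab.
  have abIS : [set a; b] \subset I :\: S.
    by rewrite subUset !sub1set !inE aS aI bS bI.
  have lvl_kk2 : (#|I :\: (k :\: k2)| < #|I :\: S|)%N.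
    rewrite -(cardsID [set a; b] (I :\: S)) (setIidPr abIS) cab addnC addn2 ltnS.
    have sub2 : I :\: (k :\: k2) \subset
        ((I :\: S) :\: [set a; b]) :|: (k2 :&: [set a; b]).
      apply/subsetP => x; have := subsetP sub x; rewrite kj !inE.
      by case: (x == a); case: (x == b); case: (x \in I); case: (x \in S);
        case: (x \in k2) => // ->.
    apply: leq_trans (subset_leq_card sub2) _.
    apply: leq_trans (leq_card_setU _ _) _.
    by rewrite -[X in (_ <= X)%N]addn1 leq_add2l.
  (* Equality could only occur if [#|I :\: S| = 2] and [k2] misses both [a] and [b]; then [k2] is
     all of [S :\: I], the excluded case. *)
  have lvl_jk2 : (#|I :\: (j :|: k2)| < #|I :\: S|)%N.
    have IjE : I :\: (j :|: k2) = [set a; b] :\: k2.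
      apply/setP => x; rewrite !inE; have := subsetP abI x; rewrite !inE.
      by case: (x == a); case: (x == b); case: (x \in I); case: (x \in k2)
        => //= ->.
    rewrite IjE ltn_neqAle (leq_trans (subset_leq_card (subsetDl _ _))) ?cab // andbT.
    apply: contra ne_SI => /eqP cE.
    have : (#|[set a; b] :\: k2| <= 2)%N by rewrite -cab subset_leq_card ?subsetDl.
    rewrite cE => le2; have cIS : #|I :\: S| = 2%N by apply/eqP; rewrite eqn_leq le2 lt1.
    have cSI : #|S :\: I| = 2%N.
      by move: cIS; rewrite !cardsD cI cS setIC.
    rewrite eqEcard c2 cSI leqnn andbT.
    have dk2 : [disjoint k2 & [set a; b]].
      rewrite disjoint_sym; apply/setDidPl/eqP.
      by rewrite eqEcard subsetDl cE cIS cab.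
    apply/subsetP => x xk2; have := subsetP sub x xk2.
    by rewrite kj inE (disjointFr dk2 xk2) orbF.
  by congr (_ * _); apply: IHm => //;
    [exact: leq_trans lvl_jk2 ltm|exact: leq_trans lvl_kk2 ltm].
have ab_in : ([set a; b] \in multi_index n 2) && ([set a; b] \subset k :\: j).
  by rewrite multi_indexE cab kj subsetUr.
have term_ab (f : {set 'I_n} -> K) : term f [set a; b] = f I * f S.
  by rewrite /term jab kab.
(* If [#|I :\: S|] is not 2, then [S :\: I] is not a pair either, and only the term at [[set a; b]]
   is left. *)
have [cIS|cIS] := eqVneq #|I :\: S| 2%N; last first.
  move: sum0; rewrite (bigD1 [set a; b] ab_in) big1 /= ?addr0 => [|k2]; last first.
    rewrite multi_indexE => /andP[/andP[/eqP c2 sub] ne_ab].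
    rewrite eq_term ?subrr ?mulr0 //; apply: contra cIS => /eqP k2E.
    by rewrite -[X in _ == X]c2 k2E !cardsD cI cS setIC.
  move/eqP; rewrite mulf_eq0 signr_eq0 !term_ab muI -mulrBr mulf_eq0.
  by rewrite (negPf lambdaI) subr_eq0 => /eqP.
have cSI : #|S :\: I| = 2%N by move: cIS; rewrite !cardsD cI cS setIC.
have ISE : I :\: S = [set a; b].
  by apply/esym/eqP; rewrite eqEcard cab cIS subUset !sub1set !inE aS aI bS bI.
(* Now the pair [S :\: I] gives a second exceptional term, in which [I] and [S] exchange roles. *)
have SI_in : ([&& (S :\: I \in multi_index n 2) & (S :\: I \subset k :\: j)]
    && (S :\: I != [set a; b])).
  rewrite multi_indexE cSI kj subsetUl /=; apply/eqP => /setP/(_ a).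
  by rewrite !inE eqxx aI.
have jSI : j :|: (S :\: I) = S.
  by rewrite /j -ISE setDDr setDv set0U setIC setID.
have kSI : k :\: (S :\: I) = I.
  rewrite /k -ISE; apply/setP => x; rewrite !inE.
  by case: (x \in I); case: (x \in S).
have term_SI (f : {set 'I_n} -> K) : term f (S :\: I) = f I * f S.
  by rewrite /term jSI kSI mulrC.
move: sum0; rewrite (bigD1 [set a; b] ab_in) (bigD1 (S :\: I) SI_in) big1 /= ?addr0 => [|k2];
  last first.
  rewrite multi_indexE => /andP[/andP[/andP[/eqP c2 sub] ne_ab] ne_SI].
  by rewrite eq_term ?subrr ?mulr0.
have jkE : symdiff j k = [set a; b] :|: (S :\: I).
  rewrite setUC -kj /symdiff (_ : j :\: k = set0) ?set0U //.
  by apply/eqP; rewrite setD_eq0 subsetU //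
    (subset_trans _ (_ : j :|: (S :\: I) \subset S)) ?subsetUl ?jSI.
have dab_SI : [disjoint [set a; b] & S :\: I].
  by rewrite -ISE -setI_eq0; apply/eqP/setP => x; rewrite !inE;
    case: (x \in I); rewrite ?andbF.
(* The inversions between the two pairs, counted in both orders, sum to 4, so the signs agree and
   the two terms add up instead of cancelling. *)
rewrite (@eq_signr K (count_gt (symdiff j k) (S :\: I))
  (count_gt (symdiff j k) [set a; b])); last first.
  rewrite jkE !(count_gtUl _ dab_SI) !count_gt_self2 // add1n addn1.
  have := congr1 odd (count_gt_swap dab_SI); rewrite cab cSI oddD /=.
  by do 2! case: (odd _).
rewrite !term_ab !term_SI muI -mulrDr -mulrBr -mulr2n -mulr_natl.
move/eqP; rewrite !mulf_eq0 signr_eq0 pnatr_eq0 (negPf lambdaI) subr_eq0.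
by move=> /eqP.
Qed.

(** When [S = I], any [i] in [I] serves with [b = i]; this is where [p > 0] enters. *)
Lemma level_le1P (p : nat) I S : #|I| = p -> #|S| = p -> (0 < p)%N ->
    (#|I :\: S| <= 1)%N ->
  exists i b, [/\ i \in I, b \notin I :\ i & S = (I :\ i) :|: [set b]].
Proof.
move=> cI cS p_gt0; rewrite leq_eqVlt ltnS leqn0 => /orP[/cards1P[i ISi]|].
  have cSI : #|S :\: I| = 1%N.
    by have := congr1 (fun A : {set 'I_n} => #|A|) ISi;
      rewrite /= cards1 !cardsD cI cS setIC.
  have /cards1P[b SIb] : #|S :\: I| == 1%N by rewrite cSI.
  have := set11 i; rewrite -ISi inE => /andP[iS iI].
  have := set11 b; rewrite -SIb inE => /andP[bI bS].
  exists i, b; split=> //; first by rewrite !inE (negPf bI) andbF.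
  by rewrite -SIb -ISi setDDr setDv set0U setIC setID.
rewrite cards_eq0 setD_eq0 => IS.
have IE : I = S by apply/eqP; rewrite eqEcard IS cI cS leqnn.
have /card_gt0P[i iI] : (0 < #|I|)%N by rewrite cI.
exists i, i; split=> //; first by rewrite !inE eqxx.
by rewrite setUC setD1K.
Qed.

Lemma two_step_relations_factor (p : nat) h : (0 < p)%N ->
    (forall S, #|S| != p -> h S = 0) -> two_step_relations p h ->
  exists2 xs, size xs = p & h = ext_prod xs.
Proof.
move=> p_gt0 h_hom h_rel.
have [|[I hI]] : h = 0 \/ exists I, h I != 0.
  case: (boolP [exists I, h I != 0]) => [/existsP|/existsPn h0]; first by right.
  by left; apply: extP => S; rewrite ext0E; apply/eqP; rewrite -[_ == _]negbK h0.
  (* For [h = 0] the list must still have length [p]: a product of [p] vectors is scaled by 0. *)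
  move=> ->; have : (0 < size (nseq p [ffun _ : 'I_n => 0%R : K]))%N.
    by rewrite size_nseq.
  by move=> /(ext_prodZ 0)[ys]; rewrite size_nseq scale0r => ? <-; exists ys.
have cI : #|I| = p by apply/eqP; apply: contraNT hI => /h_hom ->.
pose s := enum I; have s_uniq : uniq s := enum_uniq _.
have mem_s i : (i \in s) = (i \in I) by rewrite mem_enum.
have rem_s i : [set:: rem i s] = I :\ i.
  by apply/setP => b; rewrite !inE mem_rem_uniq // inE mem_s.
(* Contracting [h] by the [p - 1] covectors of [I :\ i] leaves degree 1; [X i] is the resulting
   vector. *)
pose X i : {ffun 'I_n -> K} := [ffun b => contrs (rem i s) h [set b]].
(* The sign [e b] does not depend on [f], so it cancels when two elements are compared. *)
have contrs1 i : exists e, forall f b, b \notin I :\ i ->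
    contrs (rem i s) f [set b] = (-1) ^+ e b * f ((I :\ i) :|: [set b]).
  have [e eE] := contrsE K (rem_uniq i s_uniq).
  exists (fun b => e + count_gt (I :\ i) [set b])%N => f b b_Ii.
  by rewrite eE rem_s disjoints1 b_Ii.
(* The diagonal value [X a a] is [h I] up to sign; off the diagonal, a contraction involving [a] has
   no coordinate at a set containing [a]. *)
have dual : {in s &, forall a b, (X b a == 0) = (a != b)}.
  move=> a b; rewrite !mem_s ffunE => aI bI; have [<-|ab] := eqVneq a b.
    have [e ->] := contrs1 a; last by rewrite !inE eqxx.
    by rewrite setUC setD1K // mulf_eq0 signr_eq0 (negPf hI).
  have [e ->] := contrsE K (rem_uniq b s_uniq).
  by rewrite rem_s disjoints1 !inE ab aI eqxx.
pose g := ext_prod (map X s).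
have gE i : i \in I -> exists2 c, c != 0 &
    forall b, b \notin I :\ i -> g ((I :\ i) :|: [set b]) =
      c * h ((I :\ i) :|: [set b]).
  move=> iI.
  have is_ : i \in s by rewrite mem_s.
  have [c c_neq0 cE] := contrs_prod_rem s_uniq is_ dual.
  exists c => // d d_Ii; have [e eE] := contrs1 i.
  have := congr1 (fun f : E => f [set d]) cE.
  rewrite /= extZE ext_vecE ffunE !eE // mulrCA.
  by apply: mulfI; rewrite signr_eq0.
(* The factors found for different [i] all agree, because [I] itself is among the sets compared for
   each [i]. *)
pose c := g I / h I.
have g_low i b : i \in I -> b \notin I :\ i ->
    c != 0 /\ g ((I :\ i) :|: [set b]) = c * h ((I :\ i) :|: [set b]).
  move=> iI bI; have [d d_neq0 dE] := gE i iI.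
  suff -> : c = d by rewrite dE.
  have := dE i; rewrite [_ :|: _]setUC setD1K // /c !inE eqxx => -> //.
  by rewrite mulfK.
have [i iI] : exists i, i \in I by apply/card_gt0P; rewrite cI.
have c_neq0 : c != 0 by have [] := g_low i i iI; rewrite ?inE ?eqxx.
have size_Xs : size (map X s) = p by rewrite size_map -cardE.
(* Dividing one vector by [c] turns proportionality into equality on the sets that lack at most one
   entry of [I]. *)
have [|ys size_ys ysE] := @ext_prodZ c^-1 (map X s); first by rewrite size_Xs.
rewrite size_Xs in size_ys.
exists ys => //; apply: extP => S.
have [cS|cS] := eqVneq #|S| p; last first.
  by rewrite h_hom // ext_prod_homogeneous // size_ys.
apply: (@two_step_relations_unique p h (ext_prod ys) I) => // [|T cT low].
  by rewrite -size_ys; apply: two_step_relations_prod.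
have [a [b [aI bI ->]]] := level_le1P cI cT p_gt0 low.
by rewrite ysE extZE (g_low a b aI bI).2 mulKf.
Qed.

End Factorization.

(** * Transfer to an abstract exterior algebra *)

Section SortedSets.
Variable n : nat.
Implicit Types (S T : {set 'I_n}) (i : 'I_n) (s : seq 'I_n).

Let lt_ord : rel 'I_n := fun i j => (i < j)%N.

Let lt_ord_trans : transitive lt_ord.
Proof. by move=> j i k; apply: ltn_trans. Qed.

Lemma sorted_enum_set S : sorted (fun i j : 'I_n => i < j)%N (enum S).
Proof.
rewrite /enum_mem -enumT; apply: (sorted_filter lt_ord_trans).
by have := iota_ltn_sorted 0 n; rewrite -val_enum_ord sorted_map.
Qed.

Lemma enum_set_sorted s : sorted (fun i j : 'I_n => i < j)%N s ->
  enum [set:: s] = s.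
Proof.
move=> s_sorted; apply: (irr_sorted_eq lt_ord_trans) => // [i||i].
- exact: ltnn.
- exact: sorted_enum_set.
- by rewrite mem_enum inE.
Qed.

Lemma set_seq_enum S : [set:: enum S] = S.
Proof. by apply/setP => i; rewrite inE mem_enum. Qed.

Lemma enum_setU1 i S : (forall j, j \in S -> (i < j)%N) ->
  enum (i |: S) = i :: enum S.
Proof.
move=> lt_i; rewrite -[S in LHS]set_seq_enum -set_cons enum_set_sorted //=.
rewrite path_min_sorted ?sorted_enum_set //.
by apply/allP => j; rewrite mem_enum; apply: lt_i.
Qed.

(** Adding an element below all the others prepends it to [enum], so ordered products grow by one
    factor on the left. *)
Lemma set_min_ind (P : {set 'I_n} -> Prop) : P set0 ->
    (forall i S, (forall j, j \in S -> (i < j)%N) -> P S -> P (i |: S)) ->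
  forall S, P S.
Proof.
move=> P0 PU S; rewrite -[S]set_seq_enum; have := sorted_enum_set S.
elim: (enum S) => [|i s IHs] /=; first by rewrite set_nil.
rewrite (path_sortedE lt_ord_trans) set_cons => /andP[/allP lt_i /IHs Ps].
by apply: PU Ps => j; rewrite inE; apply: lt_i.
Qed.

Lemma count_gt1_min i S : (forall j, j \in S -> (i < j)%N) ->
  count_gt [set i] S = 0%N.
Proof.
move=> lt_i; rewrite count_gtE big_set1 big1 // => j /lt_i.
by case: ltngtP.
Qed.

End SortedSets.

(** * Maps between the model and an abstract exterior algebra *)

Section Transfer.
Variables (K : numFieldType) (X : vectType K) (A : algType K).
Variables (iota : {linear X -> A}) (n : nat) (v : n.-tuple X).
Hypothesis iota_sqr0 : forall x : X, iota x * iota x = 0.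
Implicit Types (f g h : ext K n) (S T : {set 'I_n}) (i : 'I_n).

Lemma wedge0 : wedge iota v set0 = 1.
Proof. by rewrite /wedge enum_set0 big_nil. Qed.

Lemma wedge_setU1_min i S : (forall j, j \in S -> (i < j)%N) ->
  wedge iota v (i |: S) = iota (tnth v i) * wedge iota v S.
Proof. by move=> lt_i; rewrite /wedge enum_setU1 // big_cons. Qed.

Lemma iota_anticomm x y : iota x * iota y = - (iota y * iota x).
Proof.
have := iota_sqr0 (x + y); rewrite linearD mulrDl !mulrDr !iota_sqr0.
by rewrite add0r addr0 => /eqP; rewrite addr_eq0 => /eqP.
Qed.

(** Induction on the least element [a] of the set: for [i < a] nothing moves, for [i = a] the square
    vanishes, and for [i > a] anticommuting past [a] matches the extra inversion. *)
Lemma iota_wedge i S : iota (tnth v i) * wedge iota v S =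
  if i \in S then 0 else (-1) ^+ count_gt [set i] S *: wedge iota v (i |: S).
Proof.
elim/set_min_ind: S => [|a T lt_a IHT].
  rewrite inE count_gt0r scale1r wedge_setU1_min // => j; by rewrite inE.
have aT : a \notin T by apply/negP => /lt_a; rewrite ltnn.
have [ltia|ltai|/val_inj ia] := ltngtP i a.
- have lt_i j : j \in a |: T -> (i < j)%N.
    by rewrite !inE => /predU1P[->//|/lt_a]; apply: ltn_trans.
  rewrite count_gt1_min // ifN ?scale1r; last by apply/negP => /lt_i; rewrite ltnn.
  by rewrite -wedge_setU1_min.
- rewrite wedge_setU1_min // mulrA iota_anticomm mulNr -mulrA IHT !inE.
  have -> : (i == a) = false by apply: contraTF ltai => /eqP->; rewrite ltnn.
  case: ifP => _ /=; first by rewrite mulr0 oppr0.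
  rewrite -scalerAr -wedge_setU1_min; last first.
    by move=> j; rewrite !inE => /predU1P[->//|/lt_a].
  by rewrite setUCA count_gt1U // ltai add1n exprS mulN1r scaleNr.
- by rewrite ia wedge_setU1_min // mulrA iota_sqr0 mul0r !inE eqxx.
Qed.

Definition of_ext f : A := \sum_S f S *: wedge iota v S.

Fact of_ext_is_linear : linear of_ext.
Proof.
move=> a f g; rewrite /of_ext scaler_sumr -big_split; apply: eq_bigr => S _.
by rewrite extDE extZE scalerDl scalerA.
Qed.
HB.instance Definition _ :=
  GRing.isLinear.Build K (ext K n) A *:%R of_ext of_ext_is_linear.

Lemma of_ext_basisM i f :
  of_ext (ext_basis K i * f) = iota (tnth v i) * of_ext f.
Proof.
rewrite /of_ext mulr_sumr.
under eq_bigr do rewrite ext_basisM (fun_if (fun c : K => c *: _)) scale0r.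
under [RHS]eq_bigr do rewrite -scalerAr iota_wedge (fun_if ( *:%R _)) scaler0 -if_neg.
rewrite -!big_mkcond /= [LHS](reindex_onto (fun S => i |: S) (fun S => S :\ i)) /=.
  apply: eq_big => [S|S]; rewrite !inE eqxx /=.
    apply/eqP/idP => [<-|]; first by rewrite !inE eqxx.
    exact: setU1K.
  move=> /eqP SE; have iS : i \notin S by rewrite -SE !inE eqxx.
  by rewrite count_gt1U // ltnn SE scalerA mulrC.
by move=> S iS; rewrite setD1K.
Qed.

Lemma of_ext_prod (xs : seq {ffun 'I_n -> K}) :
  of_ext (ext_prod xs) = \prod_(x <- xs) iota (\sum_i x i *: tnth v i).
Proof.
elim: xs => [|x xs IHxs].
  rewrite ext_prod_nil big_nil /of_ext (bigD1 set0) //= ext1E eqxx scale1r.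
  by rewrite wedge0 big1 ?addr0 // => S /negPf S0; rewrite ext1E S0 scale0r.
rewrite ext_prod_cons big_cons -IHxs /ext_vec mulr_suml !linear_sum mulr_suml.
by apply: eq_bigr => i _; rewrite linearZ -scalerAl linearZ /= of_ext_basisM scalerAl.
Qed.

Hypothesis v_basis : basis_of {: X} v.

Definition coordinates (x : X) : {ffun 'I_n -> K} := [ffun i => coord v i x].

(** The map to which the universal property of [A] is applied, in order to send [A] to the model. *)
Definition to_ext (x : X) : ext K n := ext_vec (coordinates x).

Fact to_ext_is_linear : linear to_ext.
Proof.
move=> a x y; rewrite /to_ext /ext_vec scaler_sumr -big_split.
by apply: eq_bigr => i _; rewrite !ffunE linearP scalerDl scalerA.
Qed.
HB.instance Definition _ :=
  GRing.isLinear.Build K X (ext K n) *:%R to_ext to_ext_is_linear.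

Lemma to_ext_tnth i : to_ext (tnth v i) = ext_basis K i.
Proof.
rewrite /to_ext /ext_vec (bigD1 i) //= ffunE (tnth_nth 0).
rewrite coord_free ?(basis_free v_basis) // eqxx scale1r big1 ?addr0 // => j ji.
by rewrite ffunE coord_free ?(basis_free v_basis) // eq_sym (negPf ji) scale0r.
Qed.

End Transfer.

(** Prepending the least element creates no inversion, so no sign appears. This is how the
    coordinates of [H] are recovered from its image in the model. *)
Lemma prod_ext_basis (K : fieldType) (n : nat) (I S : {set 'I_n}) :
  (\prod_(i <- enum I) ext_basis K i) S = (S == I)%:R.
Proof.
elim/set_min_ind: I S => [|a T lt_a IHT] S; first by rewrite enum_set0 big_nil ext1E.
have aT : a \notin T by apply/negP => /lt_a; rewrite ltnn.
rewrite enum_setU1 // big_cons ext_basisM IHT.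
have [aS|aS] := boolP (a \in S); last first.
  by case: eqP aS => // ->; rewrite !inE eqxx.
have -> : (S :\ a == T) = (S == a |: T).
  by apply/eqP/eqP => [<-|->]; rewrite ?setD1K ?setU1K.
case: eqP => [->|_]; last by rewrite mulr0.
by rewrite count_gt1U // ltnn count_gt1_min // mulr1.
Qed.

(** For [j] and [k] with [p - 2] and [p + 2] entries, [j :|: k2] and [k :\: k2] both have [p]
    entries, so the relations involve no other values. *)
Lemma two_step_relations_ext (K : numFieldType) (n p : nat)
    (lambda mu : {set 'I_n} -> K) :
    (forall S : {set 'I_n}, #|S| = p -> lambda S = mu S) ->
  two_step_relations p lambda -> two_step_relations p mu.
Proof.
move=> eq_lm rel j k jp kp; rewrite -[RHS](rel j k jp kp).
apply: eq_bigr => k2; rewrite multi_indexE subsetD => /andP[/eqP c2 /andP[k2k dj]].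
move: jp kp; rewrite multi_indexB2 multi_indexD2 => /eqP cj /eqP ck.
rewrite !eq_lm //; first by rewrite cardsD (setIidPr k2k) ck c2 addnK.
by rewrite cardsU disjoint_setI0 1?disjoint_sym // cards0 subn0 c2.
Qed.

Theorem theorem4p14 (K : numFieldType) (theta : {rmorphism K -> K})
    (hK : real_or_complex theta)
    (X : vectType K) (dot : {dot X for theta})
    (n : nat) (hn : \dim {: X} = n)
    (v : n.-tuple X) (v_basis : basis_of {: X} v)
    (v_orthonormal : orthonormal dot v)
    (A : algType K) (iota : {linear X -> A})
    (hA : is_exterior_algebra iota)
    (p : nat) (lambda : {set 'I_n} -> K) (H : A)
    (hH : H = \sum_(i in multi_index n p) lambda i *: wedge iota v i) :
  is_blade iota H <->
  (forall j k : {set 'I_n},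
     j \in multi_index n (p%:Z - 2) -> k \in multi_index n (p%:Z + 2) ->
     \sum_(k2 in multi_index n 2 | k2 \subset k :\: j)
        (-1) ^+ count_gt (symdiff j k) k2
          * lambda (j :|: k2) * lambda (k :\: k2) = 0).
Proof.
case: hA => iota_sqr0 universal.
pose h : ext K n := [ffun S : {set 'I_n} => if #|S| == p then lambda S else 0].
have hE (S : {set 'I_n}) : #|S| = p -> h S = lambda S by move=> cS; rewrite ffunE cS eqxx.
have h_hom (S : {set 'I_n}) : #|S| != p -> h S = 0 by move=> /negPf cS; rewrite ffunE cS.
split=> [H_blade|rel].
  (* The morphism [g] to the model sends [H] to [h], so a factorization of [H] becomes one of
     [h]. *)
  have [|g gE _] := universal (ext K n) (to_ext v).
    by move=> x; apply: ext_vec_sqr0.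
  have g_wedge I S : g (wedge iota v I) S = (S == I)%:R.
    rewrite -(prod_ext_basis K) /wedge rmorph_prod.
    congr (fun_of_fin _ S); apply: eq_bigr => i _.
    exact: etrans (gE _) (to_ext_tnth v_basis i).
  have gH : g H = h.
    apply: extP => S; rewrite hH linear_sum ext_sumE.
    under eq_bigr => I _.
      rewrite linearZ /= extZE g_wedge.
    over.
    rewrite ffunE -multi_indexE; case: ifP => SI.
      rewrite (bigD1 S) //= eqxx mulr1 big1 ?addr0 // => I /andP[_ IS].
      by rewrite eq_sym (negPf IS) mulr0.
    rewrite big1 // => I Ip; case: eqP => [SE|_]; last exact: mulr0.
    by rewrite -SE SI in Ip.
  (* A scalar, or a product whose number of factors is not [p], falls under the first two cases: for
     [p = 0] there is no [j], and a mismatch of degrees forces [h = 0]. *)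
  suff [xs hE'] : exists xs, [\/ p = 0%N, h = 0 | size xs = p /\ h = ext_prod xs].
    case: hE' => [p0|h0|[size_xs h_prod]].
    - by move=> j k; rewrite p0 multi_indexB2 addn2.
    - move=> j k; apply: two_step_relations_ext (hE) _ j k => j k _ _.
      by rewrite big1 // => k2 _; rewrite h0 !ext0E mulr0.
    - move=> j k; apply: two_step_relations_ext (hE) _ j k.
      by rewrite h_prod -size_xs; apply: two_step_relations_prod.
  case: H_blade => [[c Hc]|[q [x [q_gt0 Hx]]]].
    exists [::]; have [p0|p_neq0] := eqVneq p 0%N; first by constructor 1.
    constructor 2; apply: extP => S; rewrite ext0E.
    have [cS|] := eqVneq #|S| p; last exact: h_hom.
    rewrite -gH Hc linearZ rmorph1 /= extZE ext1E -cards_eq0 cS.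
    by rewrite (negPf p_neq0) mulr0.
  pose xs := [seq coordinates v (x i) | i <- enum 'I_q].
  have size_xs : size xs = q by rewrite size_map size_enum_ord.
  have h_prod : h = ext_prod xs.
    rewrite -gH Hx rmorph_prod /ext_prod [RHS]big_map [index_enum _]unlock -enumT.
    by apply: eq_bigr => i _; apply: gE.
  exists xs; have [qp|qp] := eqVneq q p; first by constructor 3; rewrite size_xs.
  constructor 2; apply: extP => S; rewrite ext0E.
  have [cS|] := eqVneq #|S| p; last exact: h_hom.
  by rewrite h_prod ext_prod_homogeneous // cS size_xs eq_sym.
have of_h : of_ext iota v h = H.
  rewrite hH /of_ext [RHS]big_mkcond; apply: eq_bigr => S _.
  by rewrite ffunE multi_indexE; case: ifP; rewrite ?scale0r.
(* Degree 0 is separate: a product of vectors in [is_blade] has at least one factor, so [H] is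
   presented as a scalar. *)
have [p0|p_gt0] := posnP p.
  left; exists (lambda set0); rewrite hH (big_pred1 set0) ?wedge0 // => S.
  by rewrite multi_indexE p0 cards_eq0.
have h_rel : two_step_relations p h by apply: two_step_relations_ext rel => S /hE.
have [xs size_xs h_prod] := two_step_relations_factor p_gt0 h_hom h_rel.
(* The default value of [nth] is never reached, as [xs] has length [p]. *)
right; exists p, (fun i : 'I_p => \sum_j nth [ffun=> 0] xs i j *: tnth v j).
split=> //; rewrite -of_h h_prod of_ext_prod // (big_nth [ffun=> 0]).
by rewrite big_mkord size_xs.
Qed.
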